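(* Let $\ell\geqslant 2$ be an integer and $\varepsilon\in\{+1,-1\}$. For $d\in[1,\ell-1]$ put $$\alpha_{\ell,d}^{(\varepsilon)}=\tfrac12\ell(d-1)-\tfrac16(d+1)\big(d+\tfrac{3\varepsilon-5}{2}\big),\qquad \beta_{\ell,d}^{(\varepsilon)}=\tfrac12\ell(\ell-\varepsilon)-\tfrac16(d+1)\big(d-\tfrac{3\varepsilon-7}{2}\big),$$ and for $j\in\mathbb Z$ let $$\Gamma_{\ell,d}^{(\varepsilon)}(j)=\#\Big\{\pi\in S_\ell\ \Big|\ \#D(\pi)=d,\ j=\tfrac{\ell(\ell-\varepsilon)}{2}d-\sum_{\nu\in D(\pi)}\tfrac{\nu(\nu-\varepsilon)}{2}-\mathrm{inv}(\pi)\Big\}.$$ Define the ASH polynomial $$W_\ell^{(\varepsilon)}(X,T)=1+\sum_{d=1}^{\ell-1}\Big(\sum_{j=d\alpha_{\ell,d}^{(\varepsilon)}}^{d\beta_{\ell,d}^{(\varepsilon)}}\Gamma_{\ell,d}^{(\varepsilon)}(j)X^j\Big)T^d\in\mathbb Z[X,T].$$ Then $$W_\ell^{(\varepsilon)}(X^{-1},T^{-1})=X^{\frac{\ell(\ell-1)}{2}-\frac13(\ell-1)\ell\left(\ell+\frac{1-3\varepsilon}{4}\right)}\,T^{1-\ell}\,W_\ell^{(\varepsilon)}(X,T),$$ and for every $d\in[1,\ell-1]$ one has $\Gamma_{\ell,d}^{(\varepsilon)}(d\alpha_{\ell,d}^{(\varepsilon)})=\Gamma_{\ell,d}^{(\v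arepsilon)}(d\beta_{\ell,d}^{(\varepsilon)})=1$.
   Context: $S_\ell$ is the symmetric group on $\{1,\dots,\ell\}$. For $\pi\in S_\ell$, $\mathrm{I}(\pi)$ is the set of pairs $(i,j)$ with $i<j$ and $\pi(i)>\pi(j)$, $\mathrm{inv}(\pi)=\#\mathrm{I}(\pi)$, and $D(\pi)=\{i\in\{1,\dots,\ell\}\mid (i,i+1)\in\mathrm{I}(\pi)\}$. For integers $m\le n$, $[m,n]=\{x\in\mathbb Z\mid m\le x\le n\}$. The numbers $d\alpha_{\ell,d}^{(\varepsilon)},d\beta_{\ell,d}^{(\varepsilon)}$ are non-negative integers. *)

(* Defs.v *)
From HB Require Import structures.
From mathcomp Require Import all_boot all_order all_fingroup all_algebra.
From mathcomp Require Import ring lra.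
Set Implicit Arguments.
Unset Strict Implicit.
Unset Printing Implicit Defensive.
Import Order.TTheory GRing.Theory Num.Theory.
Local Open Scope ring_scope.

(* [S_l] acts on ['I_l] = {0, ..., l-1}: the ordinal [i] stands for the      *)
(* element i+1 of {1, ..., l}.                                               *)

Definition inv_set (l : nat) (p : 'S_l) : {set 'I_l * 'I_l} :=
  [set ij : 'I_l * 'I_l | (ij.1 < ij.2)%N && (p ij.2 < p ij.1)%N].

Definition inv (l : nat) (p : 'S_l) : nat := #|inv_set p|.

Definition descents (l : nat) (p : 'S_l) : {set 'I_l} :=
  [set i : 'I_l | [exists j : 'I_l, (j == i.+1 :> nat) && ((i, j) \in inv_set p)]].

Definition alpha (l : nat) (e : int) (d : nat) : rat :=
  l%:R * (d%:R - 1) / 2%:R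
  - (d%:R + 1) * (d%:R + (3%:R * e%:~R - 5%:R) / 2%:R) / 6%:R.

Definition beta (l : nat) (e : int) (d : nat) : rat :=
  l%:R * (l%:R - e%:~R) / 2%:R
  - (d%:R + 1) * (d%:R - (3%:R * e%:~R - 7%:R) / 2%:R) / 6%:R.

(* Both products are natural numbers for 1 <= d <= l - 1, so that [truncn]   *)
(* does not alter them: see [dalphaE] and [dbetaE].                          *)
Definition dalpha (l : nat) (e : int) (d : nat) : nat :=
  Num.truncn (d%:R * alpha l e d).
Definition dbeta (l : nat) (e : int) (d : nat) : nat :=
  Num.truncn (d%:R * beta l e d).

(* In the sum, nu = i+1 is the element of {1, ..., l} that [i] stands for.   *)
Definition ash_stat (l : nat) (e : int) (d : nat) (p : 'S_l) : rat :=
  l%:R * (l%:R - e%:~R) / 2%:R * d%:R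
  - \sum_(i in descents p) (i.+1%:R * (i.+1%:R - e%:~R) / 2%:R)
  - (inv p)%:R.

Definition Gamma (l : nat) (e : int) (d : nat) (j : int) : nat :=
  #|[set p : 'S_l | (#|descents p| == d) && (j%:~R == ash_stat e d p)]|.

(* Z[X,T] is rendered as Z[X][T]: the inner variable is X, the outer is T.   *)
Definition ash (l : nat) (e : int) : {poly {poly int}} :=
  1 + \sum_(1 <= d < l)
        (\sum_(dalpha l e d <= j < (dbeta l e d).+1)
            (Gamma l e d j%:Z)%:R *: 'X^j) *: 'X^d.

(* The value P(x, t) of P in Z[X][T].                                        *)
Definition eval2 (F : comNzRingType) (P : {poly {poly int}}) (x t : F) : F :=
  (map_poly (fun q : {poly int} => (map_poly intr q).[x]) P).[t].

(* The field Q(X, T), with its two variables.                                *)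
Notation QXT := {fraction {poly {poly int}}}.
Definition varX : QXT := tofrac ('X%:P : {poly {poly int}}).
Definition varT : QXT := tofrac ('X : {poly {poly int}}).

(* This rational number is an integer: see [ash_exponentE].                  *)
Definition ash_exponent (l : nat) (e : int) : rat :=
  l%:R * (l%:R - 1) / 2%:R
  - (l%:R - 1) * l%:R * (l%:R + (1 - 3%:R * e%:~R) / 4%:R) / 3%:R.

Lemma bin2R n : ('C(n, 2)%:R : rat) = n%:R * (n%:R - 1) / 2%:R.
Proof.
elim: n => [|n IHn]; first by rewrite bin0n !mul0r.
by rewrite binS natrD IHn bin1 -natr1; field.
Qed.

Lemma bin3R n : ('C(n, 3)%:R : rat) = n%:R * (n%:R - 1) * (n%:R - 2%:R) / 6%:R.
Proof.
elim: n => [|n IHn]; first by rewrite bin0n !mul0r.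
by rewrite binS natrD IHn bin2R -natr1; field.
Qed.

Lemma dalphaE (l : nat) (e : int) (d : nat) :
  e = 1 \/ e = -1 -> (0 < d < l)%N ->
  (dalpha l e d)%:R = d%:R * alpha l e d.
Proof.
move=> he /andP[d0 dl].
have d1 : 1 <= d%:R :> rat by rewrite ler1n.
have ld : d%:R + 1 <= l%:R :> rat by rewrite natr1 ler_nat.
have d0R : 0 <= d%:R :> rat by rewrite ler0n.
have dd : 0 <= (d%:R - 1) * d%:R * (l%:R - (d%:R + 1)) :> rat.
  by rewrite !mulr_ge0 ?subr_ge0.
have d3 : 0 <= (d%:R - 1) * d%:R * d%:R :> rat by rewrite !mulr_ge0 ?subr_ge0.
have d2 : 0 <= (d%:R - 1) * d%:R :> rat by rewrite !mulr_ge0 ?subr_ge0.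
apply: truncnK; rewrite natrEint andbC; apply/andP; split.
  suff -> : d%:R * alpha l e d =
      ((d%:R - 1) * d%:R * (l%:R - (d%:R + 1))) / 2%:R
      + ((d%:R - 1) * d%:R * d%:R + (d%:R - 1) * d%:R) / 3%:R
      + (if e == 1 then 0 else d%:R * (d%:R + 1) / 2%:R).
    apply: addr_ge0.
      by apply: addr_ge0; apply: divr_ge0 => //; apply: addr_ge0.
    by case: ifP => _ //; rewrite divr_ge0 // mulr_ge0 // addr_ge0.
  by case: he => ->; rewrite /alpha /= ?mulr1z ?mulrN1z; field.
have -> : d%:R * alpha l e d = l%:R * 'C(d, 2)%:R - 'C(d.+1, 3)%:R
    + (if e == 1 then 0 else 'C(d.+1, 2)%:R).
  by case: he => ->; rewrite /alpha !bin2R bin3R -natr1 /= ?mulr1z ?mulrN1z; field.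
apply: rpredD; last by case: ifP => _; rewrite ?rpred0 ?rpred_nat.
by apply: rpredB; [apply: rpredM|]; apply: rpred_nat.
Qed.

Lemma dbetaE (l : nat) (e : int) (d : nat) :
  e = 1 \/ e = -1 -> (0 < d < l)%N ->
  (dbeta l e d)%:R = d%:R * beta l e d.
Proof.
move=> he /andP[d0 dl].
have d1 : 1 <= d%:R :> rat by rewrite ler1n.
have ld : d%:R + 1 <= l%:R :> rat by rewrite natr1 ler_nat.
have l0 : 0 <= l%:R :> rat by rewrite ler0n.
apply: truncnK; rewrite natrEint andbC; apply/andP; split.
  apply: mulr_ge0; first by rewrite ler0n.
  by case: he => ->; rewrite /beta ?mulr1z ?mulrN1z; nra.
have -> : d%:R * beta l e d =
    (if e == 1 then d%:R * 'C(l, 2)%:R - 'C(d.+2, 3)%:R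
     else d%:R * 'C(l.+1, 2)%:R - 'C(d.+2, 3)%:R - 'C(d.+1, 2)%:R).
  by case: he => ->; rewrite /beta !bin2R bin3R -!natr1 /= ?mulr1z ?mulrN1z; field.
by case: ifP => _; do ?[apply: rpredB | apply: rpredM | apply: rpred_nat].
Qed.

Lemma ash_exponentE (l : nat) (e : int) :
  e = 1 \/ e = -1 -> (Num.floor (ash_exponent l e))%:~R = ash_exponent l e.
Proof.
move=> he; apply/eqP; rewrite -intrEfloor.
have -> : ash_exponent l e =
    (if e == 1 then - (2%:R * 'C(l, 3)%:R)
     else 'C(l, 2)%:R - 2%:R * 'C(l.+1, 3)%:R).
  by case: he => ->;
    rewrite /ash_exponent !(bin2R, bin3R) -?natr1 /= ?mulr1z ?mulrN1z; field.
case: ifP => _; first by rewrite rpredN; apply: rpredM; apply: rpred_nat.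
by do ?[apply: rpredB | apply: rpredM | apply: rpred_nat].
Qed.

Lemma eval2_var (P : {poly {poly int}}) : eval2 P varX varT = tofrac P.
Proof.
have inner (q : {poly int}) :
    (map_poly intr q).[varX] = tofrac (q%:P : {poly {poly int}}).
  elim/poly_ind: q => [|q c IHq]; first by rewrite rmorph0 horner0 polyC0 rmorph0.
  rewrite rmorphD rmorphM /= map_polyX map_polyC hornerMXaddC /= IHq.
  rewrite polyCD polyCM rmorphD rmorphM /=; congr (_ + _).
  by rewrite -[c in RHS]intz !rmorph_int.
rewrite /eval2 (eq_map_poly inner).
have -> : map_poly (fun q : {poly int} => tofrac (q%:P : {poly {poly int}})) P
  = map_poly (@tofrac {poly {poly int}} \o polyC) P by [].
elim/poly_ind: P => [|P c IHP]; first by rewrite rmorph0 horner0 rmorph0.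
by rewrite rmorphD rmorphM /= map_polyX map_polyC hornerMXaddC /= IHP rmorphD rmorphM.
Qed.

(* Main.v *)
(** Write [c v] for v(v - e)/2. Up to the term d c(l), the exponent attached to
    a permutation with d descents is minus its weight, the sum of [c v] over
    the descents v plus the number of inversions.

    Scanning the word from left to right shows that this weight is at least the
    sum of c(k) + k over 1 <= k <= d. When the k-th descent is at position v = k,
    every position up to v is a descent, so the letter at v + 1 closes k
    inversions and the bound c(k) + k is attained. When v > k, a single inversion
    suffices, because c(v) >= c(k + 1) > c(k) + k - 1. Equality forces the
    inversions to be exactly the pairs of positions in {1, ..., d + 1}, which
    determines the permutation.

    Composing with i |-> l + 1 - i complements both the descent set and the
    inversion set, so weights and descent numbers of the two permutations have
    constant sums. This gives the functional equation, and it carries the lower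
    bound for l - 1 - d descents to the upper bound for d descents. *)

Require Import Defs.
From mathcomp Require Import all_boot all_order all_fingroup all_algebra.
From mathcomp Require Import zify ring.
Set Implicit Arguments.
Unset Strict Implicit.
Unset Printing Implicit Defensive.
Import Order.TTheory GRing.Theory Num.Theory.

(** * Descents and weights of words [P 0, ..., P N] *)

Definition des_count (P : nat -> nat) (N : nat) : nat :=
  \sum_(i < N) (P i.+1 < P i).

(* The inner sum counts the inversions whose right end is position [i.+1]. *)
Definition weight (c P : nat -> nat) (N : nat) : nat :=
  \sum_(i < N) ((P i.+1 < P i) * c i.+1 + \sum_(a < i.+1) (P i.+1 < P a)).

Definition min_weight (c : nat -> nat) (d : nat) : nat :=
  \sum_(k < d) (c k.+1 + k.+1).

Lemma des_countS P N : des_count P N.+1 = des_count P N + (P N.+1 < P N).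
Proof. exact: big_ord_recr. Qed.

Lemma weightS c P N : weight c P N.+1 =
  weight c P N + ((P N.+1 < P N) * c N.+1 + \sum_(a < N.+1) (P N.+1 < P a)).
Proof. exact: big_ord_recr. Qed.

Lemma min_weightS c d : min_weight c d.+1 = min_weight c d + (c d.+1 + d.+1).
Proof. exact: big_ord_recr. Qed.

Lemma des_count_le P N : des_count P N <= N.
Proof.
elim: N => [|N IH]; first by rewrite /des_count big_ord0.
by rewrite des_countS; lia.
Qed.

(** Adjacent descents chain by transitivity, so such a word is decreasing. *)
Lemma des_count_full P N a b :
  des_count P N = N -> a < b <= N -> P b < P a.
Proof.
elim: N b => [|N IH] b; first by move=> _; lia.
rewrite des_countS; have hN := des_count_le P N.
move=> hE /andP[ab bN].
have dN : P N.+1 < P N by lia.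
have {}IH b' : a < b' <= N -> P b' < P a by apply: IH; lia.
have [bN'|bN'] := leqP b N; first by apply: IH; lia.
have -> : b = N.+1 by lia.
have [->//|aN] := eqVneq a N.
by apply: ltn_trans dN _; apply: IH; lia.
Qed.

Section MinWeight.
Variables c P : nat -> nat.
Hypothesis cP : forall i j, i < j -> c i.+1 + i < c j.+1.

Lemma weight_ge_min N : min_weight c (des_count P N) <= weight c P N.
Proof.
elim: N => [|N IH].
  by rewrite /des_count /weight /min_weight !big_ord0.
rewrite des_countS weightS.
have [dN|dN] := ltnP (P N.+1) (P N); last by rewrite addn0; lia.
rewrite addn1 min_weightS mul1n.
have := des_count_le P N; rewrite leq_eqVlt => /orP[/eqP hN|hN].
  apply: leq_add => //; rewrite hN leq_add2l.
  rewrite (eq_bigr (fun=> 1)) ?sum1_card ?card_ord // => a _.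
  have hS : des_count P N.+1 = N.+1 by rewrite des_countS dN hN addn1.
  by rewrite (des_count_full hS) // ltn_ord leqnn.
(* The new descent comes late: [cP] with [i = des_count P N] and [j = N], together with the single
   inversion [(N, N.+1)], already exceeds the required term. *)
apply: leq_add => //; rewrite big_ord_recr /= dN.
by have := cP hN; lia.
Qed.

(** Strictness in [cP] rules out late descents, and a last letter that is not preceded by a descent
    can close no inversion. *)
Lemma weight_eq_min N a b :
  weight c P N = min_weight c (des_count P N) -> a < b <= N ->
  (P b < P a) = (b <= des_count P N).
Proof.
elim: N b => [|N IH] b; first by lia.
rewrite des_countS weightS.
have le_min := weight_ge_min N.
have [dN|dN] := ltnP (P N.+1) (P N).
  rewrite addn1 min_weightS mul1n.
  have := des_count_le P N; rewrite leq_eqVlt => /orP[/eqP hN|hN].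
    move=> _ ab; have hS : des_count P N.+1 = N.+1 by rewrite des_countS dN hN addn1.
    by rewrite (des_count_full hS) // hN; lia.
  by rewrite big_ord_recr /= dN; have := cP hN; lia.
rewrite mul0n add0n addn0 => hE /andP[ab bN].
have [bN'|bN'] := leqP b N; first by apply: IH; lia.
have bE : b = N.+1 by lia.
have /eqP : \sum_(a < N.+1) (P N.+1 < P a) = 0 by lia.
rewrite sum_nat_eq0 => /forallP col0.
have aN : a < N.+1 by rewrite -bE.
have := col0 (Ordinal aN); rewrite eqb0 bE /= => /negbTE ->.
by have := des_count_le P N; lia.
Qed.

End MinWeight.

(** * Words with complementary inversions *)

Section Complement.
Variables (c P Q : nat -> nat) (N : nat).
Hypothesis PQ : forall i j, i < j <= N -> (Q j < Q i) = ~~ (P j < P i).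

Lemma des_count_compl : des_count P N + des_count Q N = N.
Proof.
rewrite -big_split /= (eq_bigr (fun=> 1)) ?sum1_card ?card_ord // => i _.
by rewrite PQ ?ltnSn ?ltn_ord //; case: ltnP.
Qed.

Lemma weight_compl : weight c P N + weight c Q N = min_weight c N.
Proof.
rewrite -big_split /=; apply: eq_bigr => i _.
rewrite addnACA -big_split /=; congr (_ + _).
  by rewrite PQ ?ltnSn ?ltn_ord //; case: ltnP => _; lia.
rewrite (eq_bigr (fun=> 1)) ?sum1_card ?card_ord // => a _.
by rewrite PQ ?ltn_ord //=; case: ltnP.
Qed.

End Complement.

(** * Weights of permutations *)

Section Perm.
Variable n : nat.
Implicit Types p q : 'S_n.+1.

(** [inord] sends indices beyond [n] to 0, whence the guard [i < n] in [mem_descents]. *)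
Definition perm_nat p (i : nat) : nat := p (inord i).

Lemma mem_descents p (i : 'I_n.+1) :
  (i \in descents p) = (i < n) && (perm_nat p i.+1 < perm_nat p i).
Proof.
rewrite inE; apply/existsP/andP => [[j /andP[/eqP ji]]|[i_n dp]].
  rewrite inE /= => /andP[_ dp]; rewrite /perm_nat inord_val -ji inord_val.
  by split=> //; have := ltn_ord j; rewrite ji.
exists (inord i.+1); rewrite inE /= inordK ?eqxx ?ltnSn //=.
by move: dp; rewrite /perm_nat inord_val.
Qed.

Lemma sum_descents p (f : nat -> nat) :
  \sum_(i in descents p) f i.+1
  = \sum_(i < n) (perm_nat p i.+1 < perm_nat p i) * f i.+1.
Proof.
rewrite big_mkcond big_ord_recr /= mem_descents ltnn /= addn0.
by apply: eq_bigr => i _; rewrite mem_descents /= ltn_ord /=; case: ifP; rewrite ?mul1n.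
Qed.

Lemma card_descents p : #|descents p| = des_count (perm_nat p) n.
Proof.
rewrite -sum1_card (sum_descents p (fun=> 1)).
by apply: eq_bigr => i _; rewrite muln1.
Qed.

Lemma invE p :
  Defs.inv p = \sum_(i < n) \sum_(a < i.+1) (perm_nat p i.+1 < perm_nat p a).
Proof.
rewrite /Defs.inv -sum1_card big_mkcond /=.
transitivity (\sum_(a < n.+1) \sum_(b < n.+1) nat_of_bool ((a < b) && (p b < p a))).
  by rewrite pair_bigA /=; apply: eq_bigr => ab _; rewrite inE; case: ifP.
(* No inversion has right end 0; the other right ends are [i.+1] with [i < n]. *)
rewrite exchange_big /= big_ord_recl big1 ?add0n => [|a _]; last by rewrite ltn0.
apply: eq_bigr => i _; rewrite -[i.+1]/(bump 0 i).
rewrite [RHS](big_ord_widen n.+1 (fun a => nat_of_bool (perm_nat p i.+1 < perm_nat p a))).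
  rewrite [RHS]big_mkcond /=; apply: eq_bigr => a _.
  rewrite /= /bump /= add1n; case: ltnP => //= _.
  rewrite /perm_nat inord_val; congr (nat_of_bool (_ < _)).
  by congr (nat_of_ord (p _)); apply: val_inj; rewrite /= inordK ?ltnS.
by rewrite ltnW // ltnS.
Qed.

Definition perm_weight c p : nat := weight c (perm_nat p) n.

Lemma perm_weightE c p :
  perm_weight c p = \sum_(i in descents p) c i.+1 + Defs.inv p.
Proof. by rewrite (sum_descents p c) invE -big_split. Qed.

(** Each value is the number of smaller values, so comparisons determine it; injectivity settles the
    pairs of positions taken in decreasing order. *)
Lemma perm_eq_of_inversions p q :
  (forall a b, a < b <= n -> (perm_nat p b < perm_nat p a) = (perm_nat q b < perm_nat q a)) ->
  p = q.
Proof.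
move=> pq.
have pq' (a b : 'I_n.+1) : (p b < p a) = (q b < q a).
  have lt_pq (a' b' : 'I_n.+1) : a' < b' -> (p b' < p a') = (q b' < q a').
    by move=> ab; have := pq a' b'; rewrite /perm_nat !inord_val; apply; rewrite ab -ltnS ltn_ord.
  case: (ltngtP a b) => [|ba|/val_inj->]; first exact: lt_pq.
    have p_ab : (p a : nat) != p b by rewrite (inj_eq val_inj) (inj_eq perm_inj) neq_ltn ba orbT.
    have q_ab : (q a : nat) != q b by rewrite (inj_eq val_inj) (inj_eq perm_inj) neq_ltn ba orbT.
    by have := lt_pq _ _ ba; lia.
  by rewrite !ltnn.
have rank (s : 'S_n.+1) a : (s a : nat) = #|[set b | s b < s a]|.
  have -> : [set b | s b < s a] = s @^-1: [set y : 'I_n.+1 | y < s a].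
    by apply/setP => b; rewrite !inE.
  rewrite on_card_preimset; last by exists (s^-1)%g => x _; rewrite ?permK ?permKV.
  rewrite -sum1_card (eq_bigl (fun y : 'I_n.+1 => y < s a)) => [|y]; last by rewrite inE.
  by rewrite -(big_ord_widen n.+1 (fun=> 1)) ?sum1_card ?card_ord // ltnW.
apply/permP => a; apply: val_inj; rewrite /= (rank p) (rank q).
by apply: eq_card => b; rewrite !inE pq'.
Qed.

(** The left factor of a product acts first, so values are reversed and positions kept. *)
Definition perm_compl p : 'S_n.+1 := (p * perm (@rev_ord_inj n.+1))%g.

Lemma perm_complK : involutive perm_compl.
Proof. by move=> p; apply/permP => i; rewrite !permM !permE rev_ordK. Qed.

Lemma perm_nat_compl p i j : i < j <= n ->
  (perm_nat (perm_compl p) j < perm_nat (perm_compl p) i)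
  = ~~ (perm_nat p j < perm_nat p i).
Proof.
move=> /andP[ij jn]; rewrite /perm_nat !permM !permE /= !subSS.
have : (p (inord i) : nat) != p (inord j).
  rewrite (inj_eq val_inj) (inj_eq perm_inj) -(inj_eq val_inj) /= !inordK //; lia.
have := ltn_ord (p (inord i)); have := ltn_ord (p (inord j)); lia.
Qed.

Lemma card_descents_compl p : #|descents p| + #|descents (perm_compl p)| = n.
Proof. by rewrite !card_descents; apply/des_count_compl/perm_nat_compl. Qed.

Lemma perm_weight_compl c p :
  perm_weight c p + perm_weight c (perm_compl p) = min_weight c n.
Proof. exact/weight_compl/perm_nat_compl. Qed.

(** The minimiser [d, ..., 1, 0, d+1, ..., n]: its inversions are the pairs that [weight_eq_min]
    forces. *)
Definition rev_prefix_fun (d : nat) (i : 'I_n.+1) : 'I_n.+1 :=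
  inord (if i <= d then d - i else i).

Lemma rev_prefix_inj d : d <= n -> injective (rev_prefix_fun d).
Proof.
move=> dn i j /(congr1 val); have := ltn_ord i; have := ltn_ord j.
move=> jn i_n; rewrite /= !inordK; [|case: ifP; lia..].
by move=> ij; apply: val_inj => /=; move: ij; do 2!case: ifP; lia.
Qed.

Definition rev_prefix d (dn : d <= n) : 'S_n.+1 := perm (rev_prefix_inj dn).

Lemma rev_prefixE d (dn : d <= n) i : i <= n ->
  perm_nat (rev_prefix dn) i = if i <= d then d - i else i.
Proof.
move=> i_n; rewrite /perm_nat permE /rev_prefix_fun (@inordK n i) //.
by rewrite inordK //; case: ifP; lia.
Qed.

Lemma rev_prefix_inv d (dn : d <= n) a b : a < b <= n ->
  (perm_nat (rev_prefix dn) b < perm_nat (rev_prefix dn) a) = (b <= d).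
Proof. by move=> ab; rewrite !rev_prefixE; [do 2!case: ifP; lia|lia..]. Qed.

Lemma card_descents_rev_prefix d (dn : d <= n) : #|descents (rev_prefix dn)| = d.
Proof.
rewrite card_descents /des_count (eq_bigr (fun i : 'I_n => nat_of_bool (i < d))).
  rewrite -[RHS]card_ord -sum1_card (big_ord_widen n (fun=> 1)) // [RHS]big_mkcond.
  by apply: eq_bigr => i _; case: ltnP.
by move=> i _; rewrite rev_prefix_inv ?ltnSn ?ltn_ord.
Qed.

Lemma perm_weight_rev_prefix c d (dn : d <= n) :
  perm_weight c (rev_prefix dn) = min_weight c d.
Proof.
rewrite /perm_weight /weight /min_weight (big_ord_widen n (fun k => c k.+1 + k.+1)) //.
rewrite [RHS]big_mkcond /=; apply: eq_bigr => i _.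
rewrite rev_prefix_inv ?ltnSn ?ltn_ord //.
rewrite (eq_bigr (fun=> nat_of_bool (i < d))) => [|a _].
  by rewrite sum_nat_const card_ord; case: ifP; lia.
by rewrite rev_prefix_inv // !ltn_ord.
Qed.

(** * Extremal weights for a given number of descents *)

Section Extremal.
Variable c : nat -> nat.
Hypothesis cP : forall i j, i < j -> c i.+1 + i < c j.+1.

Lemma perm_weight_ge p : min_weight c #|descents p| <= perm_weight c p.
Proof. by rewrite card_descents weight_ge_min. Qed.

(** This is the lower bound for the complement, which has [n - #|descents p|] descents. *)
Lemma perm_weight_le p :
  perm_weight c p + min_weight c (n - #|descents p|) <= min_weight c n.
Proof.
have dn : #|descents (perm_compl p)| = n - #|descents p|.
  by have := card_descents_compl p; lia.
by rewrite -(perm_weight_compl c p) leq_add2l -dn perm_weight_ge.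
Qed.

Lemma card_min_weight d : d <= n ->
  #|[set p | (#|descents p| == d) && (perm_weight c p == min_weight c d)]| = 1.
Proof.
move=> dn; rewrite -(cards1 (rev_prefix dn)); congr #|pred_of_set _|.
apply/setP => p; rewrite !inE; apply/andP/eqP => [[/eqP pd /eqP pw]|->].
  apply: perm_eq_of_inversions => a b ab; rewrite rev_prefix_inv //.
  by rewrite (weight_eq_min cP _ ab) -card_descents ?pd.
by rewrite card_descents_rev_prefix perm_weight_rev_prefix !eqxx.
Qed.

(** Complementation maps these bijectively onto the permutations of least weight with [n - d]
    descents. *)
Lemma card_max_weight d : d <= n ->
  #|[set p | (#|descents p| == d) &&
             (perm_weight c p + min_weight c (n - d) == min_weight c n)]| = 1.
Proof.
move=> dn; rewrite -(card_min_weight (leq_subr d n)).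
rewrite -[RHS](card_preimset _ (inv_inj perm_complK)); apply: eq_card => p.
rewrite !inE; have := perm_weight_compl c p; have := card_descents_compl p; lia.
Qed.

End Extremal.
End Perm.

(** * The ASH polynomial *)

Local Open Scope ring_scope.

(* This is v(v - e)/2 when e = 1 or e = -1: see [ash_coefE]. *)
Definition ash_coef (e : int) (v : nat) : nat := 'C(v + (e != 1), 2).

(** By Pascal's rule the values at [i.+1] and [i.+2] differ by at least [i.+1]; monotonicity does
    the rest. *)
Lemma ash_coef_lt e i j :
  (i < j)%N -> (ash_coef e i.+1 + i < ash_coef e j.+1)%N.
Proof.
move=> ij; apply: (@leq_trans (ash_coef e i.+2)).
  by rewrite /ash_coef !addSn [in leqRHS]binS bin1; lia.
by apply: leq_bin2l; rewrite leq_add2r ltnS.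
Qed.

Section Numbers.
Variable e : int.
Hypothesis he : e = 1 \/ e = -1.

Lemma ash_coefE v : (ash_coef e v)%:R = v%:R * (v%:R - e%:~R) / 2%:R :> rat.
Proof.
rewrite /ash_coef; case: he => -> /=; first by rewrite addn0 bin2R.
by rewrite addn1 bin2R -natr1 mulrN1z; field.
Qed.

Lemma min_weightE d : (min_weight (ash_coef e) d)%:R =
  d%:R * (d%:R + 1) * (2%:R * d%:R + 7%:R - 3%:R * e%:~R) / 12%:R :> rat.
Proof.
elim: d => [|d IH]; first by rewrite /min_weight big_ord0 !mul0r.
rewrite min_weightS natrD IH natrD ash_coefE -natr1.
by case: he => ->; rewrite ?mulr1z ?mulrN1z; field.
Qed.

Variable n : nat.

(** Makes [dbeta] the degree at least weight; the additive form avoids truncated subtraction. *)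
Lemma dbeta_min d : (0 < d <= n)%N ->
  (dbeta n.+1 e d + min_weight (ash_coef e) d = d * ash_coef e n.+1)%N.
Proof.
move=> dn; apply/eqP; rewrite -(eqr_nat rat) natrD natrM dbetaE // min_weightE ash_coefE.
by apply/eqP; rewrite /beta -natr1; field.
Qed.

(** Makes [dalpha] the degree at greatest weight, in the form given by [perm_weight_le]. *)
Lemma dalpha_max d : (0 < d <= n)%N ->
  (dalpha n.+1 e d + min_weight (ash_coef e) n
   = d * ash_coef e n.+1 + min_weight (ash_coef e) (n - d))%N.
Proof.
move=> dn; apply/eqP; rewrite -(eqr_nat rat) !natrD natrM dalphaE // !min_weightE ash_coefE.
rewrite natrB; last by case/andP: dn.
apply/eqP; rewrite /alpha -natr1.
by case: he => ->; rewrite ?mulr1z ?mulrN1z; field.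
Qed.

(** By [ash_degree_compl], this is minus the sum of the degrees of a permutation and its
    complement. *)
Lemma ash_exponent_weight :
  Num.floor (ash_exponent n.+1 e)
  = (min_weight (ash_coef e) n)%:Z - (n * ash_coef e n.+1)%:Z.
Proof.
apply: (intr_inj (R := rat)); rewrite ash_exponentE // intrB -!pmulrn natrM.
rewrite min_weightE ash_coefE /ash_exponent -natr1.
by case: he => ->; rewrite ?mulr1z ?mulrN1z; field.
Qed.

Lemma ash_statE d (p : 'S_n.+1) :
  ash_stat e d p = (d * ash_coef e n.+1)%:R - (perm_weight (ash_coef e) p)%:R.
Proof.
rewrite /ash_stat perm_weightE natrD natrM ash_coefE natr_sum opprD addrA.
rewrite [_ * d%:R]mulrC; congr (_ - _ - _).
by apply: eq_bigr => i _; rewrite ash_coefE.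
Qed.

Lemma GammaE d (j : nat) :
  Gamma n.+1 e d j%:Z = #|[set p : 'S_n.+1 | (#|descents p| == d) &&
     (j + perm_weight (ash_coef e) p == d * ash_coef e n.+1)%N]|.
Proof.
apply: eq_card => p; rewrite !inE ash_statE; congr (_ && _).
by rewrite -pmulrn eq_sym subr_eq eq_sym -natrD eqr_nat.
Qed.

Lemma Gamma_dbeta d : (0 < d <= n)%N -> Gamma n.+1 e d (dbeta n.+1 e d) = 1%N.
Proof.
move=> dn; rewrite GammaE -(card_min_weight (@ash_coef_lt e) (d := d) (n := n)); last by lia.
by apply: eq_card => p; rewrite !inE -dbeta_min // eqn_add2l.
Qed.

Lemma Gamma_dalpha d : (0 < d <= n)%N -> Gamma n.+1 e d (dalpha n.+1 e d) = 1%N.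
Proof.
move=> dn; rewrite GammaE -(card_max_weight (@ash_coef_lt e) (d := d) (n := n)); last by lia.
by apply: eq_card => p; rewrite !inE; have := dalpha_max dn; lia.
Qed.

(* The subtraction does not truncate: see [ash_degreeK]. *)
Definition ash_degree (p : 'S_n.+1) : nat :=
  #|descents p| * ash_coef e n.+1 - perm_weight (ash_coef e) p.

Lemma card_descents_le (p : 'S_n.+1) : (#|descents p| <= n)%N.
Proof. by have := card_descents_compl p; lia. Qed.

Lemma perm_weight_no_descents (p : 'S_n.+1) :
  #|descents p| = 0%N -> perm_weight (ash_coef e) p = 0%N.
Proof.
move=> p0; have := perm_weight_le (@ash_coef_lt e) p.
by rewrite p0 subn0 -{2}[min_weight _ _]add0n leq_add2r leqn0 => /eqP.
Qed.

Lemma ash_degreeK (p : 'S_n.+1) :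
  (ash_degree p + perm_weight (ash_coef e) p = #|descents p| * ash_coef e n.+1)%N.
Proof.
(* [dalpha_max] covers only positive descent numbers, so 0 is treated apart. *)
apply: subnK; have [/perm_weight_no_descents -> //|p0] := posnP #|descents p|.
have dn : (0 < #|descents p| <= n)%N by rewrite p0 card_descents_le.
have := dalpha_max dn; have := perm_weight_le (@ash_coef_lt e) p; lia.
Qed.

(** Ensures that the range of [j] in [ash] omits no permutation with a descent. *)
Lemma ash_degree_bounds (p : 'S_n.+1) : (0 < #|descents p|)%N ->
  (dalpha n.+1 e #|descents p| <= ash_degree p <= dbeta n.+1 e #|descents p|)%N.
Proof.
move=> p0; have dn : (0 < #|descents p| <= n)%N by rewrite p0 card_descents_le.
have := dalpha_max dn; have := dbeta_min dn; have := ash_degreeK p.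
have := perm_weight_le (@ash_coef_lt e) p; have := perm_weight_ge (@ash_coef_lt e) p.
lia.
Qed.

(** Accounts for the leading 1 of [ash]. *)
Lemma card_no_descents : #|[set p : 'S_n.+1 | #|descents p| == 0%N]| = 1%N.
Proof.
rewrite -(card_min_weight (@ash_coef_lt e) (leq0n n)); apply: eq_card => p; rewrite !inE.
case: eqP => //= /perm_weight_no_descents ->.
by rewrite /min_weight big_ord0.
Qed.

(** In this form complementation acts by reindexing. *)
Lemma ash_sum :
  ash n.+1 e = \sum_(p : 'S_n.+1) 'X^(ash_degree p) *: 'X^#|descents p|.
Proof.
rewrite (bigID (fun p => #|descents p| == 0%N)) /= /ash; congr (_ + _).
  rewrite (eq_bigr (fun=> 1)) => [|p /eqP p0].
    by rewrite sumr_const -cardsE card_no_descents.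
  by rewrite /ash_degree p0 mul0n sub0n !expr0 scale1r.
pose G d j (p : 'S_n.+1) : {poly {poly int}} :=
  if (#|descents p| == d) && (j + perm_weight (ash_coef e) p == d * ash_coef e n.+1)%N
  then 'X^j *: 'X^d else 0.
transitivity (\sum_p \sum_(1 <= d < n.+1)
    \sum_(dalpha n.+1 e d <= j < (dbeta n.+1 e d).+1) G d j p).
  rewrite [RHS]exchange_big; apply: eq_big_nat => d _.
  rewrite [RHS]exchange_big scaler_suml; apply: eq_big_nat => j _.
  rewrite GammaE scaler_nat -sumr_const scaler_suml big_mkcond.
  by apply: eq_bigr => p _; rewrite inE.
rewrite [RHS]big_mkcond; apply: eq_bigr => p _ /=.
have jE j : (j + perm_weight (ash_coef e) p == #|descents p| * ash_coef e n.+1)%N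
    = (j == ash_degree p) by rewrite -ash_degreeK eqn_add2r.
(* For fixed [p], only [d = #|descents p|] and [j = ash_degree p] contribute. *)
rewrite (eq_bigr (fun d => if d == #|descents p| then
    \sum_(dalpha n.+1 e d <= j < (dbeta n.+1 e d).+1) G d j p else 0)) => [|d _].
  rewrite -big_mkcond big_nat1_eq ltnS card_descents_le andbT lt0n.
  case: eqP => //= /eqP; rewrite -lt0n => /ash_degree_bounds bp.
  rewrite (eq_bigr (fun j => if j == ash_degree p
      then 'X^j *: 'X^#|descents p| else 0)) => [|j _]; last by rewrite /G eqxx jE.
  by rewrite -big_mkcond big_nat1_eq ltnS bp.
by case: eqP => // /eqP pd; rewrite big1 // => j _; rewrite /G eq_sym (negbTE pd).
Qed.

Lemma ash_degree_compl (p : 'S_n.+1) :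
  (ash_degree p + ash_degree (perm_compl p) + min_weight (ash_coef e) n
   = n * ash_coef e n.+1)%N.
Proof.
rewrite -(perm_weight_compl _ p) addnACA !ash_degreeK -mulnDl.
by rewrite card_descents_compl.
Qed.

End Numbers.

(** * Evaluation and the functional equation *)

Lemma eval2_sum (F : comNzRingType) (I : finType) (f g : I -> nat) (x t : F) :
  eval2 (\sum_i 'X^(f i) *: 'X^(g i)) x t = \sum_i x ^+ f i * t ^+ g i.
Proof.
(* As a composite of ring morphisms, the inner evaluation makes [map_poly] a morphism too. *)
rewrite /eval2 -[fun q => _]/(horner_eval x \o map_poly intr).
rewrite rmorph_sum horner_sum; apply: eq_bigr => i _.
rewrite -mul_polyC rmorphM /= map_polyC map_polyXn hornerM hornerC hornerXn /=.
by rewrite map_polyXn /horner_eval hornerXn.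
Qed.

Lemma exprVn_exprz (F : fieldType) (x : F) (a b : nat) (k : int) :
  x != 0 -> k = - a%:Z - b%:Z -> x^-1 ^+ a = x ^ k * x ^+ b.
Proof. by move=> x0 ->; rewrite expfzDr // -!exprnN exprVn divfK ?expf_neq0. Qed.

(** Reindexing by [perm_compl] matches the terms one by one: for both exponents, the sum over a
    permutation and its complement is constant. *)
Lemma ash_eval2V (F : fieldType) (n : nat) (e : int) (x t : F) :
  e = 1 \/ e = -1 -> x != 0 -> t != 0 ->
  eval2 (ash n.+1 e) x^-1 t^-1
    = x ^ Num.floor (ash_exponent n.+1 e) * t ^ (1 - n.+1%:Z)
      * eval2 (ash n.+1 e) x t.
Proof.
move=> he x0 t0.
rewrite ash_sum // !eval2_sum (reindex_inj (inv_inj (@perm_complK n))) mulr_sumr.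
apply: eq_bigr => p _; rewrite mulrACA; congr (_ * _).
  apply: exprVn_exprz => //; rewrite ash_exponent_weight //.
  by have := ash_degree_compl he p; lia.
by apply: exprVn_exprz => //; have := card_descents_compl p; lia.
Qed.

Theorem theorem1p7 (l : nat) (e : int) (hl : (2 <= l)%N) (he : e = 1 \/ e = -1) :
  eval2 (ash l e) varX^-1 varT^-1
    = varX ^ Num.floor (ash_exponent l e) * varT ^ (1 - l%:Z)
      * eval2 (ash l e) varX varT
  /\ (forall d : nat, (1 <= d <= l - 1)%N ->
        Gamma l e d (dalpha l e d)%:Z = 1%N
        /\ Gamma l e d (dbeta l e d)%:Z = 1%N).
Proof.
case: l hl => // n _; split; last first.
  by move=> d; rewrite subn1 => dn; rewrite Gamma_dalpha ?Gamma_dbeta.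
by apply: ash_eval2V; rewrite // tofrac_eq0 ?polyC_eq0 polyX_eq0.
Qed.
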